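(* Let $K$ be a field, $S=K[x_1,\dots,x_n]$, and let $I\subseteq S$ be a left PLP-polymatroidal ideal with data $k$, $d$, $b_1,\dots,b_k$, $\alpha_{k+1},\dots,\alpha_n$, $\beta_{k+1},\dots,\beta_n$; set $\alpha_k:=0$. For $A\subseteq\{1,\dots,n\}$ let $P_A=(x_i:i\in A)$. Then $P_A\in\operatorname{Ass}(S/I)$ if and only if either (a) $A=B\cup[k+1,t]$, where $B\subseteq[1,k]$, $k+1\le t\le n$, and $$\sum_{j\in[1,k]\setminus B}b_j<\min\{\alpha_t,\beta_{k+1}\},\quad \alpha_{t-1}<\alpha_t,\quad \alpha_i<\beta_i\ \text{ for all } i=k+1,\dots,t-1,$$ or (b) $A=[s,t]$, where $k+2\le s\le t\le n$, and $$\beta_{s-1}<\beta_s,\quad \alpha_{t-1}<\alpha_t,\quad \beta_{s-1}<\alpha_t,\quad \alpha_i<\beta_i\ \text{ for all } i=s,\dots,t-1.$$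
   Context: For integers $p\le q$, $[p,q]=\{p,p+1,\dots,q\}$. Left PLP-polymatroidal ideal: let $n,k,d$ be positive integers with $1\le k\le n-1$, let $b_1,\dots,b_k$ be positive integers and let $\alpha_i,\beta_i$ $(k+1\le i\le n)$ be non-negative integers with $\alpha_i\le\beta_i$ for all $i$, $\alpha_{k+1}\le\cdots\le\alpha_n=d$ and $\beta_{k+1}\le\cdots\le\beta_n=d$. The corresponding left PLP-polymatroidal ideal $I$ is the monomial ideal of $S$ generated by all $x_1^{u_1}\cdots x_n^{u_n}$, with $u_i$ non-negative integers, such that $0\le u_i\le b_i$ for $1\le i\le k$ and $\alpha_i\le u_1+\cdots+u_i\le\beta_i$ for $i=k+1,\dots,n$. *)

(* Defs.v *)
From mathcomp Require Export all_boot all_order all_algebra.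
From mathcomp.multinomials Require Export mpoly.

Set Implicit Arguments.
Unset Strict Implicit.
Unset Printing Implicit Defensive.

Import GRing.Theory.
Local Open Scope ring_scope.

(* Ideals are Prop-valued predicates: the ideals of ring_quotient.v are boolean
   and proper by definition, whereas generated ideals over an arbitrary field
   come with no decision procedure. *)
Section Ideals.
Variable R : comNzRingType.
Implicit Types (G J P : R -> Prop).

Definition ideal J : Prop :=
  [/\ J 0,
      (forall x y, J x -> J y -> J (x + y)) &
      (forall a x, J x -> J (a * x))].

Definition prime_ideal P : Prop :=
  [/\ ideal P, ~ P 1 & forall x y, P (x * y) -> P x \/ P y].

Definition ideal_gen G : R -> Prop := fun x =>
  exists (m : nat) (c g : 'I_m -> R),
    (forall i, G (g i)) /\ x = \sum_(i < m) c i * g i.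

(* The annihilator in R of the class f + J of R / J: r (f + J) = 0 means that
   r * f lies in J. *)
Definition ann_class J (f : R) : R -> Prop := fun r => J (r * f).

(* P is in Ass(R / J). *)
Definition associated_prime J P : Prop :=
  prime_ideal P /\ exists f : R, forall r, P r <-> ann_class J f r.

End Ideals.

(* Labels are 1-based: the variable x_i is 'X_j for the j : 'I_n with
   j.+1 = i, and subsets of {1, ..., n} are sets of such j.  The set [p, q]: *)
Definition itv_set (n p q : nat) : {set 'I_n} :=
  [set j : 'I_n | (p <= j.+1 <= q)%N].

(* P_A = (x_i : i in A). *)
Definition var_ideal (K : fieldType) (n : nat) (A : {set 'I_n}) :
    {mpoly K[n]} -> Prop :=
  ideal_gen (fun p : {mpoly K[n]} => exists2 j : 'I_n, j \in A & p = 'X_j).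

(* The families are functions on nat, of which only the values b i for
   1 <= i <= k, and alpha i, beta i for k + 1 <= i <= n, are data. *)
Definition left_PLP_data (n k d : nat) (b alpha beta : nat -> nat) : Prop :=
  [/\ (0 < d)%N /\ (1 <= k < n)%N,
      (forall i, (1 <= i <= k)%N -> (0 < b i)%N),
      (forall i, (k + 1 <= i <= n)%N -> (alpha i <= beta i)%N),
      (forall i, (k + 1 <= i < n)%N -> (alpha i <= alpha i.+1)%N) /\ alpha n = d &
      (forall i, (k + 1 <= i < n)%N -> (beta i <= beta i.+1)%N) /\ beta n = d].

Definition left_PLP_exponent (n k : nat) (b alpha beta : nat -> nat)
    (u : 'X_{1..n}) : Prop :=
  (forall j : 'I_n, (j.+1 <= k)%N -> (u j <= b j.+1)%N) /\
  (forall i, (k + 1 <= i <= n)%N ->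
     (alpha i <= \sum_(j in itv_set n 1 i) u j <= beta i)%N).

Definition left_PLP_ideal (K : fieldType) (n k : nat)
    (b alpha beta : nat -> nat) : {mpoly K[n]} -> Prop :=
  ideal_gen (fun p : {mpoly K[n]} =>
    exists2 u : 'X_{1..n}, left_PLP_exponent k b alpha beta u & p = 'X_[u]).

(* Main.v *)
(** A monomial ideal I has P_A as an associated prime iff some monomial x^w
satisfies: x^(w+v) is in I exactly when v meets A.  For a left PLP-polymatroidal
ideal, taking partial sums greedily shows that x^w is in I iff
[alpha_i <= sum_(l <= k) min(w_l, b_l) + w_(k+1) + ... + w_i] for [k < i <= n]
and [alpha_i <= beta_j + w_(j+1) + ... + w_i] for [k < j < i <= n].
Make w large off A.  An inequality violated at w fails by exactly 1 and
involves precisely the variables of A; this is case (a) for the first family and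
case (b), with [s, t] = [j+1, i], for the second.  Since adding any variable of
A repairs everything, comparing the two inequalities that split the violated one
gives the strict inequalities.  Conversely, partial sums [max(alpha_i, sigma)]
for [i < t] and [alpha_t - 1] at t, where sigma is the sum of the b_j outside B,
resp. [beta_(s-1)], define such a w. *)

From Stdlib Require Import Classical.
Require Import Defs.
From mathcomp Require Import zify.

Set Implicit Arguments.
Unset Strict Implicit.
Unset Printing Implicit Defensive.

Import GRing.Theory.

(** * Associated monomial primes of monomial ideals *)

Section MonomialIdeals.
Local Open Scope ring_scope.

Lemma ideal_gen_ideal (R : comNzRingType) (G : R -> Prop) : ideal (ideal_gen G).
Proof.
split.
- by exists 0%N, (fun=> 0), (fun=> 0); rewrite big_ord0; split=> // - [].
- move=> x y [m [c [g [Gg ->]]]] [m' [c' [g' [Gg' ->]]]].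
  exists (m + m')%N,
    (fun i => match split i with inl j => c j | inr j => c' j end),
    (fun i => match split i with inl j => g j | inr j => g' j end).
  split=> [i|]; first by case: (split i).
  by rewrite big_split_ord; congr (_ + _); apply: eq_bigr => i _;
     [case: (splitP (lshift _ i)) | case: (splitP (rshift _ i))] => j /= e;
     [congr (c _ * g _) | have := ltn_ord i | have := ltn_ord j
     | congr (c' _ * g' _)]; try apply: val_inj => /=; lia.
- move=> a x [m [c [g [Gg ->]]]]; exists m, (fun i => a * c i), g; split=> //.
  by rewrite mulr_sumr; apply: eq_bigr => i _; rewrite mulrA.
Qed.

Variables (K : fieldType) (n : nat).
Implicit Types (p q f : {mpoly K[n]}) (u v w m : 'X_{1..n}) (A : {set 'I_n}).
Implicit Types G : 'X_{1..n} -> Prop.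

Definition monomial_gen G p : Prop := exists2 u, G u & p = 'X_[u].

(** The exponents of the monomials lying in the ideal generated by [G]. *)
Definition upclosure G m : Prop := exists2 u, G u & (u <= m)%MM.

(** Multiplying by ['X_[u]] shifts supports by [u], and a monomial in the support of a sum occurs in
    some summand. *)
Lemma monomial_idealP G p :
  ideal_gen (monomial_gen G) p <-> {in msupp p, forall m, upclosure G m}.
Proof.
split=> [[r [c [g [Gg ->]]]] m | Gp].
  rewrite mcoeff_msupp linear_sum /= => nz.
  have [i nzi] : exists i : 'I_r, (c i * g i)@_m != 0.
    apply/existsP; apply: contraNT nz; rewrite negb_exists => /forallP z.
    by apply/eqP/big1 => i _; apply/eqP; rewrite -[_ == _]negbK.
  have [u Gu gi] := Gg i; exists u => //; move: nzi.
  rewrite gi -mcoeff_msupp (perm_mem (msuppMX _ _)) => /mapP[m' _ ->].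
  by apply/mnm_lepP => j; rewrite mnmDE leq_addr.
have [I0 ID IM] := ideal_gen_ideal (monomial_gen G).
rewrite (mpolyE p); elim: (msupp p) Gp => [|m s IHs] Gs.
  by rewrite big_nil.
rewrite big_cons; apply: ID; last first.
  by apply: IHs => x xs; apply: Gs; rewrite inE xs orbT.
have [u Gu /submK<-] := Gs m (mem_head _ _).
rewrite mpolyXD scalerAl; apply: IM.
exists 1%N, (fun=> 1), (fun=> 'X_[u]); split=> [_|]; first by exists u.
by rewrite big_ord1 mul1r.
Qed.

Lemma monomial_ideal_mulX G p w :
  ideal_gen (monomial_gen G) (p * 'X_[w]) <->
  {in msupp p, forall m, upclosure G (w + m)%MM}.
Proof.
split=> [/monomial_idealP Gpw m mp | Gp].
  by apply: Gpw; rewrite (perm_mem (msuppMX _ _)); apply: map_f.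
apply/monomial_idealP => x.
by rewrite (perm_mem (msuppMX _ _)) => /mapP[m mp ->]; apply: Gp.
Qed.

Definition touches A v : bool := [exists j in A, (0 < v j)%N].

(** P_A is itself monomial, generated by the unit exponents [U_(j)] with [j] in [A]. *)
Lemma var_idealP A p :
  var_ideal A p <-> {in msupp p, forall m, touches A m}.
Proof.
pose G u := exists2 j, j \in A & u = U_(j)%MM.
have GA q : var_ideal A q <-> ideal_gen (monomial_gen G) q.
  split=> - [r [c [g [Gg ->]]]]; exists r, c, g; split=> // i.
    by have [j jA ->] := Gg i; exists U_(j)%MM => //; exists j.
  by have [_ [j jA ->] ->] := Gg i; exists j.
have upG m : upclosure G m <-> touches A m.
  split=> [[_ [j jA ->]] /mnm_lepP/(_ j) | /existsP[j /andP[jA mj]]].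
    by rewrite mnm1E eqxx => mj; apply/existsP; exists j; rewrite jA.
  exists U_(j)%MM; first by exists j.
  by apply/mnm_lepP => i; rewrite mnm1E; case: eqP => // <-.
rewrite GA; split=> [/monomial_idealP Gp m mp | Gp].
  by apply/upG/Gp.
by apply/monomial_idealP => m mp; apply/upG/Gp.
Qed.

Definition zero_vars A :=
  [tuple if j \in A then 0 else 'X_j : {mpoly K[n]} | j < n].

Lemma zero_vars_X A m :
  'X_[m] \mPo zero_vars A = if touches A m then 0 else 'X_[m].
Proof.
rewrite comp_mpolyX; case: ifP => [/existsP[j /andP[jA mj]] | /negbT].
  by rewrite (bigD1 j) //= tnth_mktuple jA expr0n eqn0Ngt mj mul0r.
rewrite negb_exists => /forallP nA; rewrite mpolyXE_id.
apply: eq_bigr => j _; rewrite tnth_mktuple.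
have := nA j; case: (j \in A) => //=; rewrite -eqn0Ngt => /eqP->.
by rewrite !expr0.
Qed.

(** The substitution kills the monomials of P_A and fixes all others, so surviving terms cannot
    cancel. *)
Lemma zero_vars_eq0P A p : p \mPo zero_vars A = 0 <-> var_ideal A p.
Proof.
have E : p \mPo zero_vars A =
    \sum_(m <- msupp p) p@_m *: (if touches A m then 0 else 'X_[m]).
  by rewrite {1}(mpolyE p) linear_sum /=; apply: eq_bigr => m _;
     rewrite linearZ /= zero_vars_X.
split=> [p0 | /var_idealP Ap]; last first.
  by rewrite E big1_seq // => m /= mp; rewrite Ap // scaler0.
apply/var_idealP => m mp; apply: contraT => nAm.
have: (p \mPo zero_vars A)@_m != 0; last by rewrite p0 mcoeff0 eqxx.
rewrite E linear_sum /= (bigD1_seq m) ?msupp_uniq //= ifN //.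
rewrite mcoeffZ mcoeffX eqxx mulr1 big1 ?addr0 -?mcoeff_msupp // => m' nm.
rewrite mcoeffZ; case: ifP => _; first by rewrite mcoeff0 mulr0.
by rewrite mcoeffX (negbTE nm) mulr0.
Qed.

(* P_A is the kernel of the substitution x_j := 0 for j in A. *)
Lemma var_ideal_prime A : prime_ideal (@var_ideal K n A).
Proof.
split; first exact: ideal_gen_ideal.
  move=> /var_idealP/(_ 0%MM); rewrite msupp1 mem_head => /(_ isT).
  by case/existsP=> j; rewrite mnm0E andbF.
move=> x y /zero_vars_eq0P; rewrite rmorphM => /eqP.
by rewrite mulf_eq0 => /orP[]/eqP/zero_vars_eq0P; [left | right].
Qed.

(** If P_A annihilates exactly the class of [f], then it does so already for some monomial of [f];
    this reduces the theorem to exponents. *)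
Lemma var_ideal_associatedP G A :
  associated_prime (ideal_gen (monomial_gen G)) (var_ideal (K := K) A) <->
  exists w, forall v, upclosure G (w + v)%MM <-> touches A v.
Proof.
have AX v : var_ideal (K := K) A 'X_[v] <-> touches A v.
  split=> [/var_idealP | vA]; first by apply; rewrite msuppX mem_head.
  by apply/var_idealP => m; rewrite msuppX inE => /eqP->.
split=> [[_ [f Af]] | [w Aw]]; last first.
  split; first exact: var_ideal_prime.
  exists 'X_[w] => r; rewrite /ann_class.
  split=> [/var_idealP Ar | /monomial_ideal_mulX Gr].
    by apply/monomial_ideal_mulX => m mr; apply/Aw/Ar.
  by apply/var_idealP => m mr; apply/Aw/Gr.
have Gup m v : upclosure G m -> upclosure G (m + v)%MM.
  case=> u Gu /mnm_lepP um; exists u => //; apply/mnm_lepP => j.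
  by rewrite mnmDE (leq_trans (um j)) ?leq_addr.
have AfX v : touches A v <-> {in msupp f, forall m, upclosure G (m + v)%MM}.
  rewrite -AX Af /ann_class mulrC; split=> [/monomial_ideal_mulX|] H.
    by move=> m mf; rewrite addmC; apply: H.
  by apply/monomial_ideal_mulX => m mf; rewrite addmC; apply: H.
(* Otherwise each monomial of f is carried into the ideal by some monomial
   outside P_A; the product of these carries f itself into it. *)
apply: NNPP => noW.
have bad m : m \in msupp f ->
    exists v, ~~ touches A v /\ upclosure G (m + v)%MM.
  move=> mf; apply: NNPP => nov; apply: noW; exists m => v; split=> [Gmv|].
    by apply: contraT => nAv; case: nov; exists v.
  by move/AfX; apply.
have [v [nAv Gv]] : exists v, ~~ touches A v /\
    {in msupp f, forall m, upclosure G (m + v)%MM}.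
  elim: (msupp f : seq _) bad => [|m s IHs] bad.
    exists 0%MM; split=> //; rewrite negb_exists; apply/forallP => j.
    by rewrite mnm0E andbF.
  have [|v [nAv Gv]] := IHs.
    by move=> x xs; apply: bad; rewrite inE xs orbT.
  have [v' [nAv' Gv']] := bad m (mem_head _ _).
  exists (v + v')%MM; split=> [|x].
    move: nAv nAv'; rewrite !negb_exists => /forallP a /forallP a'.
    apply/forallP => j; have := a j; have := a' j; rewrite mnmDE.
    by case: (j \in A) => //=; lia.
  rewrite inE => /predU1P[-> | /Gv Gxv]; last by rewrite addmA; apply: Gup.
  by rewrite [(v + v')%MM]addmC addmA; apply: Gup.
by case/negP: nAv; apply/AfX.
Qed.

End MonomialIdeals.

(** * Sums of exponents over intervals of labels *)

Section IntervalSums.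
Variable n : nat.
Implicit Types (u v w : 'X_{1..n}) (p q r : nat).

Definition seg w p q : nat := \sum_(j in itv_set n p q) w j.

Lemma seg_empty w p q : q < p -> seg w p q = 0.
Proof. by move=> qp; rewrite /seg big_pred0 // => j; rewrite inE; lia. Qed.

Lemma seg_recr w p q (qn : q < n) : p <= q.+1 ->
  seg w p q.+1 = seg w p q + w (Ordinal qn).
Proof.
move=> pq; rewrite /seg addnC.
have -> : itv_set n p q.+1 = Ordinal qn |: itv_set n p q.
  by apply/setP => j; rewrite !inE -val_eqE /=; lia.
by rewrite big_setU1 // inE /=; lia.
Qed.

Lemma seg_cat w p q r : p <= q.+1 -> q <= r <= n ->
  seg w p r = seg w p q + seg w q.+1 r.
Proof.
move=> pq; elim: r => [|r IHr] qr.
  by rewrite (_ : q = 0) ?[seg w 1 0]seg_empty ?addn0 //; lia.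
have [->|qr'] : q = r.+1 \/ q <= r by lia.
  by rewrite [seg w r.+2 _]seg_empty ?addn0.
have rn : r < n by lia.
by rewrite !(seg_recr w rn) ?IHr ?addnA //; lia.
Qed.

Lemma seg_ge w (j : 'I_n) p q : p <= j.+1 <= q -> w j <= seg w p q.
Proof. by move=> jpq; rewrite /seg (bigD1 j) ?inE ?leq_addr. Qed.

Lemma segD v w p q : seg (v + w)%MM p q = seg v p q + seg w p q.
Proof. by rewrite -big_split; apply: eq_bigr => j _; rewrite mnmDE. Qed.

Lemma seg_unit (j : 'I_n) p q : seg U_(j)%MM p q = (p <= j.+1 <= q).
Proof.
rewrite /seg; case: (boolP (_ <= _ <= _)) => jpq.
  rewrite (bigD1 j) ?inE //= mnm1E eqxx big1 // => i /andP[_ ij].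
  by rewrite mnm1E eq_sym (negbTE ij).
rewrite big1 // => i; rewrite inE mnm1E => ipq.
by case: eqP => // ji; rewrite ji ipq in jpq.
Qed.

Lemma leq_seg v w p q : (forall j : 'I_n, p <= j.+1 <= q -> v j <= w j) ->
  seg v p q <= seg w p q.
Proof. by move=> vw; apply: leq_sum => j; rewrite inE => /vw. Qed.

Lemma eq_seg v w p q : (forall j : 'I_n, p <= j.+1 <= q -> v j = w j) ->
  seg v p q = seg w p q.
Proof. by move=> vw; apply: eq_bigr => j; rewrite inE => /vw. Qed.

(** Monotonicity of [P] makes the truncated subtractions exact. The greedy exponent and the critical
    monomials both consist of such increments. *)
Lemma seg_telescope w (P : nat -> nat) p q : p <= q <= n ->
  (forall i, p <= i < q -> P i <= P i.+1) ->
  (forall j : 'I_n, p < j.+1 <= q -> w j = P j.+1 - P j) ->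
  P p + seg w p.+1 q = P q.
Proof.
elim: q => [|q IHq] pqn homP wP.
  by rewrite seg_empty ?addn0 // (_ : p = 0) //; lia.
have [->|pq] : p = q.+1 \/ p <= q by lia.
  by rewrite seg_empty ?addn0.
have qn : q < n by lia.
have IH : P p + seg w p.+1 q = P q.
  by apply: IHq => [|i ?|j ?]; [lia | apply: homP; lia | apply: wP; lia].
have Pq : P q <= P q.+1 by apply: homP; lia.
by rewrite (seg_recr w qn) // addnA IH wP /=; lia.
Qed.

End IntervalSums.

(** * Monomials of a left PLP-polymatroidal ideal *)

Section PLP.
Variables (n k d : nat) (b alpha beta : nat -> nat).
Hypothesis hdata : left_PLP_data n k d b alpha beta.
Implicit Types (u v w : 'X_{1..n}) (A : {set 'I_n}).

Lemma PLP_k : 0 < k < n. Proof. by case: hdata => -[_ ?]; lia. Qed.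

Lemma PLP_b_gt0 i : 0 < i <= k -> 0 < b i.
Proof. by case: hdata => _ b0 _ _ _ ?; apply: b0; lia. Qed.

Lemma PLP_alpha_beta i : k < i <= n -> alpha i <= beta i.
Proof. by case: hdata => _ _ ab _ _ ?; apply: ab; lia. Qed.

Lemma PLP_alpha_mono i j : k < i -> i <= j <= n -> alpha i <= alpha j.
Proof.
case: hdata => _ _ _ [am _] _ ki; elim: j => [|j IHj] ij; first by lia.
have [->//|ij'] : i = j.+1 \/ i <= j by lia.
by apply: leq_trans (am j _); [apply: IHj; lia | lia].
Qed.

Lemma PLP_beta_mono i j : k < i -> i <= j <= n -> beta i <= beta j.
Proof.
case: hdata => _ _ _ _ [bm _] ki; elim: j => [|j IHj] ij; first by lia.
have [->//|ij'] : i = j.+1 \/ i <= j by lia.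
by apply: leq_trans (bm j _); [apply: IHj; lia | lia].
Qed.

Lemma PLP_alpha_le i : k < i <= n -> alpha i <= d.
Proof.
move=> ki; have := @PLP_alpha_mono i n; case: hdata => _ _ _ [_ ->] _.
by apply; lia.
Qed.

(** The largest exponent below [w] that respects the caps [b]. *)
Definition trunc w : 'X_{1..n} :=
  [multinom if j.+1 <= k then minn (w j) (b j.+1) else w j | j < n].

Lemma seg_trunc w p q : k < p -> seg (trunc w) p q = seg w p q.
Proof. by move=> kp; apply: eq_seg => j ?; rewrite mnmE ifN //; lia. Qed.

Lemma trunc_cat w i : k <= i <= n ->
  seg (trunc w) 1 i = seg (trunc w) 1 k + seg w k.+1 i.
Proof. by move=> ki; rewrite (@seg_cat _ _ 1 k) // (@seg_trunc _ k.+1). Qed.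

Definition PLP_ineqs w : Prop :=
  (forall i, k < i <= n -> alpha i <= seg (trunc w) 1 i) /\
  (forall j i, k < j < i -> i <= n -> alpha i <= beta j + seg w j.+1 i).

(** A generator dividing x^w has exponent below [trunc w], and its entries after [j] must lift a
    partial sum of at most [beta j] to at least [alpha i]. *)
Lemma exponent_PLP_ineqs w :
  upclosure (left_PLP_exponent k b alpha beta) w -> PLP_ineqs w.
Proof.
case=> u [ub uab] /mnm_lepP uw.
have uT j : u j <= trunc w j.
  by rewrite mnmE; case: ifP => // jk; rewrite leq_min uw ub.
have le_ui i : k < i <= n -> alpha i <= seg u 1 i <= beta i.
  by move=> ?; apply: uab; lia.
split=> [i ki | j i kj ni].
  apply: leq_trans (leq_seg _ (v := u)); last by move=> j _; apply: uT.
  by have := le_ui i; lia.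
have := @seg_cat _ u 1 j i; have := le_ui i; have := le_ui j.
have: seg u j.+1 i <= seg w j.+1 i by apply: leq_seg.
lia.
Qed.

(* Largest partial sums available below w.  Before k + 1 the cap
   beta (k + 1) is applied, so that the caps are nondecreasing. *)
Fixpoint greedy w i : nat :=
  if i is i'.+1 then
    minn (greedy w i' + nth 0 (trunc w) i') (beta (maxn k.+1 i))
  else 0.

Lemma greedy_succ w (j : 'I_n) :
  greedy w j.+1 = minn (greedy w j + trunc w j) (beta (maxn k.+1 j.+1)).
Proof. by rewrite /= [trunc w j in RHS](tnth_nth 0). Qed.

Lemma greedy_le w i : 0 < i -> greedy w i <= beta (maxn k.+1 i).
Proof. by case: i => // i _; rewrite /= geq_minr. Qed.

Lemma greedy_mono w i : i < n -> greedy w i <= greedy w i.+1.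
Proof.
move=> ni /=; rewrite leq_min leq_addr /=.
case: i ni => // i ni; apply: leq_trans (greedy_le w (ltn0Sn i)) _.
by have k0n := PLP_k; apply: PLP_beta_mono; lia.
Qed.

(** Unrolling the recursion stops at the last [j] where the cap cut the sum, or runs down to 0 if
    there is none. *)
Lemma greedy_expand w i : i <= n ->
  greedy w i = seg (trunc w) 1 i \/
  exists2 j, 0 < j <= i &
    greedy w i = beta (maxn k.+1 j) + seg (trunc w) j.+1 i.
Proof.
elim: i => [|i IHi] ni; first by left; rewrite seg_empty.
rewrite (greedy_succ w (Ordinal ni)) minnE; set x := _ - _.
have [xle | xgt] :=
  leqP (greedy w i + trunc w (Ordinal ni)) (beta (maxn k.+1 i.+1)).
  have -> : x = greedy w i + trunc w (Ordinal ni) by rewrite /x /=; lia.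
  have [|->|[j ji ->]] := IHi; first by lia.
    by left; rewrite (seg_recr _ ni).
  by right; exists j; [lia | rewrite (seg_recr _ ni) ?addnA //; lia].
right; exists i.+1; first by lia.
by rewrite seg_empty // addn0 /x /=; lia.
Qed.

(** The increments of [greedy w] form a generator dividing x^w: upper bounds are built in, and the
    inequalities make each greedy sum reach [alpha i]. *)
Lemma PLP_ineqs_exponent w :
  PLP_ineqs w -> upclosure (left_PLP_exponent k b alpha beta) w.
Proof.
case=> alphaT alphaS; have k0n := PLP_k.
pose u : 'X_{1..n} := [multinom greedy w j.+1 - greedy w j | j < n].
have uT j : u j <= trunc w j.
  by rewrite mnmE greedy_succ leq_subLR geq_minl.
have segu i : i <= n -> seg u 1 i = greedy w i.
  move=> ni; rewrite -(@seg_telescope _ u (greedy w) 0 i) //.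
    by move=> j ji; apply: greedy_mono; lia.
  by move=> j _; rewrite mnmE.
exists u; last first.
  apply/mnm_lepP => j; apply: leq_trans (uT j) _.
  by rewrite mnmE; case: ifP => // _; rewrite geq_minl.
split=> [j jk | i ki]; first by have := uT j; rewrite [trunc w j]mnmE jk; lia.
rewrite -/(seg u 1 i) segu; last by lia.
apply/andP; split; last first.
  by have := @greedy_le w i; rewrite (_ : maxn k.+1 i = i); lia.
have [|->|[j ji ->]] := @greedy_expand w i; first by lia.
  by apply: alphaT; lia.
(* A cut at a label up to [k] used the cap of k + 1, so the comparison starts there instead,
   dropping some terms of the sum. *)
pose j' := maxn k.+1 j.
have le_seg : seg w j'.+1 i <= seg (trunc w) j.+1 i.
  have [le_j'i|gt_j'i] := leqP j' i; last by rewrite seg_empty; lia.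
  rewrite -seg_trunc ?(@seg_cat _ (trunc w) j.+1 j' i) ?leq_addl //; lia.
have [ij'|j'i] : i = j' \/ j' < i by lia.
  by rewrite -/j' -ij'; have := @PLP_alpha_beta i; lia.
by have := alphaS j' i; rewrite -/j'; lia.
Qed.

Lemma PLP_upclosureP w :
  upclosure (left_PLP_exponent k b alpha beta) w <-> PLP_ineqs w.
Proof. by split; [apply: exponent_PLP_ineqs | apply: PLP_ineqs_exponent]. Qed.

End PLP.

(** * Critical monomials *)

Lemma ord_of_label n l : 0 < l <= n -> exists j : 'I_n, j.+1 = l.
Proof.
by case: l => // l ln; have ln' : l < n by []; exists (Ordinal ln').
Qed.

Section AssociatedPrimes.
Variables (n k d : nat) (b alpha beta : nat -> nat).
Hypothesis hdata : left_PLP_data n k d b alpha beta.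
Implicit Types (u v w : 'X_{1..n}) (A B : {set 'I_n}).

Local Notation trunc := (trunc k b).
Local Notation PLP_ineqs := (PLP_ineqs k b alpha beta).

Lemma PLP_ineqs_fail w : ~ PLP_ineqs w ->
  (exists2 t, k < t <= n & seg (trunc w) 1 t < alpha t) \/
  (exists s t, [/\ k.+1 < s <= t, t <= n & beta s.-1 + seg w s t < alpha t]).
Proof.
move=> nw; apply: NNPP => nex; apply: nw; split=> [i ki | j i kji ni].
  by rewrite leqNgt; apply/negP => ?; apply: nex; left; exists i.
rewrite leqNgt; apply/negP => ?; apply: nex; right; exists j.+1, i.
by split=> //; lia.
Qed.

(** Entrywise, min(x + y, b) <= min(x, b) + y. An extra variable thus raises a truncated sum by at
    most 1, and only if its label is in range. *)
Lemma seg_truncD w u p q :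
  seg (trunc (w + u)%MM) p q <= seg (trunc w) p q + seg u p q.
Proof.
by rewrite -segD; apply: leq_seg => j _; rewrite mnmDE !mnmE; case: ifP; lia.
Qed.

(** * Necessity: reading [A] off a violated inequality *)

Section CriticalMonomial.
Variables (A : {set 'I_n}) (w : 'X_{1..n}).
Hypothesis w_next : forall j, j \in A -> PLP_ineqs (w + U_(j))%MM.
(** Off [A], [trunc] then equals [b] up to label [k]; at later labels the entry is at least every
    [alpha i], so it cannot occur in a violated inequality. *)
Hypothesis w_large : forall j : 'I_n, j \notin A -> d + b j.+1 <= w j.

Lemma critical_prefix t : alpha k = 0 -> k < t <= n ->
  seg (trunc w) 1 t < alpha t ->
  exists (B : {set 'I_n}) (t : nat),
     [/\ A = B :|: itv_set n (k + 1) t,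
         B \subset itv_set n 1 k,
         k + 1 <= t <= n &
         [/\ \sum_(j in itv_set n 1 k :\: B) b j.+1
                < minn (alpha t) (beta (k + 1)),
             alpha (t - 1) < alpha t &
             forall i, k + 1 <= i <= t - 1 -> alpha i < beta i]].
Proof.
move=> alphak kt fail_t; have k0n := PLP_k hdata.
have dt : alpha t <= d by apply: (PLP_alpha_le hdata).
have At j : j \in A -> j.+1 <= t.
  move=> /w_next[/(_ t kt) + _]; have := seg_truncD w U_(j)%MM 1 t.
  by rewrite seg_unit; lia.
have tA (j : 'I_n) : k < j.+1 <= t -> j \in A.
  move=> kjt; apply: contraT => /w_large.
  have : trunc w j <= seg (trunc w) 1 t by apply: seg_ge; lia.
  by rewrite mnmE ifN; lia.
have [jt jtE] : exists j : 'I_n, j.+1 = t by apply: ord_of_label; lia.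
have [jk jkE] : exists j : 'I_n, j.+1 = k.+1 by apply: ord_of_label; lia.
have [jtT _] : PLP_ineqs (w + U_(jt))%MM by apply/w_next/tA; lia.
have [_ jkS] : PLP_ineqs (w + U_(jk))%MM by apply/w_next/tA; lia.
(* The variable with label [t] does not occur in sums ending before [t], so these inequalities hold
   at [w] already. *)
have left_i i : k < i < t -> alpha i <= seg (trunc w) 1 i.
  move=> ki; have := jtT i; have := seg_truncD w U_(jt)%MM 1 i.
  by rewrite seg_unit; lia.
(* Likewise the variable with label k + 1 does not occur in sums starting after [i]. *)
have right_i i : k < i < t -> alpha t <= beta i + seg w i.+1 t.
  by move=> ki; have := jkS i t; rewrite segD seg_unit; lia.
have cat_i i : k <= i <= t ->
    seg (trunc w) 1 t = seg (trunc w) 1 i + seg w i.+1 t.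
  move=> ki; rewrite (@seg_cat _ _ 1 i) ?[seg _ i.+1 t](@seg_trunc _ k) //; lia.
pose B := A :&: itv_set n 1 k.
have sumB : \sum_(j in itv_set n 1 k :\: B) b j.+1 <= seg (trunc w) 1 k.
  rewrite /seg [X in _ <= X](big_setID B) /=; apply: leq_trans (leq_addl _ _).
  apply: leq_sum => j; rewrite !inE => jB; rewrite mnmE ifT; last by lia.
  have /w_large : j \notin A by lia.
  by lia.
have cat_k := cat_i k.
(* For t > k + 1, the violated inequality and [right_i] at k + 1 share the terms after k + 1;
   cancelling them bounds the sum by [beta k.+1]. *)
have sum_beta : seg (trunc w) 1 k < beta k.+1.
  have := PLP_alpha_beta hdata (i := k.+1).
  have [tk|kt1] : t = k.+1 \/ k.+1 < t by lia.
    by rewrite -tk; lia.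
  have := right_i k.+1; have := cat_i k.+1; have := @trunc_cat n k b w k.+1.
  by lia.
exists B, t; split; rewrite ?subsetIr ?addn1 //.
  apply/setP => j; rewrite !inE; have := At j; have := tA j.
  by case: (j \in A) => /=; lia.
split=> [|| i ki].
- by rewrite leq_min; lia.
- have [tk|kt1] : t = k.+1 \/ k.+1 < t by lia.
    by rewrite tk subn1 /= alphak -tk; lia.
  by have := left_i (t - 1); have := cat_i (t - 1); lia.
- by have := left_i i; have := right_i i; have := cat_i i; lia.
Qed.

(** The same comparisons as for a prefix, with [beta s.-1] in place of the truncated sum over the
    first [k] labels. *)
Lemma critical_interval s t :
  k.+1 < s <= t -> t <= n -> beta s.-1 + seg w s t < alpha t ->
  exists s t : nat,
     [/\ A = itv_set n s t,
         k + 2 <= s /\ s <= t <= n &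
         [/\ beta (s - 1) < beta s,
             alpha (t - 1) < alpha t,
             beta (s - 1) < alpha t &
             forall i, s <= i <= t - 1 -> alpha i < beta i]].
Proof.
move=> kst tn fail_st; have k0n := PLP_k hdata.
have dt : alpha t <= d by apply: (PLP_alpha_le hdata); lia.
have Ast j : j \in A -> s <= j.+1 <= t.
  move=> /w_next[_ /(_ s.-1 t)]; rewrite prednK; last by lia.
  by rewrite segD seg_unit; lia.
have stA (j : 'I_n) : s <= j.+1 <= t -> j \in A.
  move=> sjt; apply: contraT => /w_large.
  have : w j <= seg w s t by apply: seg_ge.
  by lia.
have [jt jtE] : exists j : 'I_n, j.+1 = t by apply: ord_of_label; lia.
have [js jsE] : exists j : 'I_n, j.+1 = s by apply: ord_of_label; lia.
have [_ jtS] : PLP_ineqs (w + U_(jt))%MM by apply/w_next/stA; lia.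
have [_ jsS] : PLP_ineqs (w + U_(js))%MM by apply/w_next/stA; lia.
have left_i i : s <= i < t -> alpha i <= beta s.-1 + seg w s i.
  move=> si; have := jtS s.-1 i; rewrite prednK; last by lia.
  by rewrite segD seg_unit; lia.
have right_i i : s <= i < t -> alpha t <= beta i + seg w i.+1 t.
  by move=> si; have := jsS i t; rewrite segD seg_unit; lia.
have cat_i i : s <= i <= t -> seg w s t = seg w s i + seg w i.+1 t.
  by move=> si; apply: seg_cat; lia.
have ab := PLP_alpha_beta hdata.
exists s, t; split; first 1 last.
- by split; lia.
- rewrite subn1; split=> [||| i si].
  (* For s = t, both strict increases come from alpha (t-1) <= beta (t-1) < alpha t <= beta t. *)
  + have [st|st] : s = t \/ s < t by lia.
      by have := ab t; move: fail_st; rewrite st; lia.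
    by have := right_i s; have := cat_i s; lia.
  + have [st|st] : s = t \/ s < t by lia.
      by have := ab t.-1; move: fail_st; rewrite st subn1; lia.
    by have := left_i (t - 1); have := cat_i (t - 1); lia.
  + by lia.
  + by have := left_i i; have := right_i i; have := cat_i i; lia.
- apply/setP => j; rewrite !inE; have := Ast j; have := stA j.
  by case: (j \in A) => /=; lia.
Qed.

End CriticalMonomial.

(** * Sufficiency: building critical monomials *)

(* The partial sums along [s, t] of a critical monomial: every inequality
   inside [s, t] holds, except that the one for the whole interval fails by 1. *)
Lemma critical_profile s t sigma : k < s <= t -> t <= n ->
  alpha s.-1 <= sigma -> alpha t.-1 < alpha t -> sigma < alpha t ->
  (s < t -> sigma < beta s) -> (forall i, s <= i < t -> alpha i < beta i) ->
  exists P : nat -> nat,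
    [/\ P s.-1 = sigma, (P t).+1 = alpha t,
        forall i, s.-1 <= i < t -> P i <= P i.+1 &
        forall i, s <= i < t -> alpha i <= P i < beta i].
Proof.
move=> kst tn s1 t1 st sb ab.
(* At s - 1 the maximum is [sigma]; the final step does not decrease since [alpha t.-1] and [sigma]
   are both below [alpha t]. *)
exists (fun i => if i < t then maxn (alpha i) sigma else (alpha t).-1).
split=> [||i si|i si].
- by rewrite ifT; lia.
- by rewrite ltnn; lia.
- rewrite ifT; last by lia.
  have [it|it] : i.+1 = t \/ i.+1 < t by lia.
    by have iE : i = t.-1 by [lia]; rewrite it ltnn iE; lia.
  rewrite it geq_max leq_maxr andbT leq_max.
  have [->|is_] : i = s.-1 \/ s <= i by lia.
    by rewrite s1 orbT.
  by rewrite (PLP_alpha_mono hdata) //; lia.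
- have := ab i si; have := sb; have := PLP_beta_mono hdata (i := s) (j := i).
  by rewrite ifT; lia.
Qed.

(** The zero branch serves the labels of [B] in case (a); in case (b) no label of [A] is below
    [s]. *)
Definition critical A s (P : nat -> nat) : 'X_{1..n} :=
  [multinom if j \in A then (if j.+1 < s then 0 else P j.+1 - P j)
            else d + b j.+1 | j < n].

Lemma seg_large A s P v (j : 'I_n) p q i : j \notin A -> p <= j.+1 <= q ->
  k < i <= n -> alpha i <= seg (critical A s P + v)%MM p q.
Proof.
move=> jA jpq /(PLP_alpha_le hdata) di.
apply: leq_trans di (leq_trans _ (seg_ge _ jpq)).
by rewrite mnmDE mnmE (negbTE jA); lia.
Qed.

(** The label must exceed [k], where [trunc] leaves the large entry intact. *)
Lemma seg_trunc_large A s P v (j : 'I_n) q i : j \notin A -> k < j.+1 <= q ->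
  k < i <= n -> alpha i <= seg (trunc (critical A s P + v)%MM) 1 q.
Proof.
move=> jA kjq /(PLP_alpha_le hdata) di.
have jq : 1 <= j.+1 <= q by lia.
apply: leq_trans di (leq_trans _ (seg_ge _ jq)).
by rewrite mnmE ifN ?mnmDE ?mnmE ?(negbTE jA); lia.
Qed.

Lemma seg_critical A s t P i j : 0 < s -> t <= n ->
  (forall l : 'I_n, s <= l.+1 <= t -> l \in A) ->
  (forall l, s.-1 <= l < t -> P l <= P l.+1) ->
  s.-1 <= i <= j -> j <= t ->
  P i + seg (critical A s P) i.+1 j = P j.
Proof.
move=> s0 tn stA Pm si jt; apply: seg_telescope => [|l ?|l ?]; first by lia.
  by apply: Pm; lia.
by rewrite mnmE stA ?ifN //; lia.
Qed.

Lemma not_touches A v : ~~ touches A v -> forall j, j \in A -> v j = 0.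
Proof.
by rewrite negb_exists => /forallP nA j jA; have := nA j; rewrite jA; lia.
Qed.

(** Without a variable of [A] the sum at [t] stays at alpha t - 1; a variable of [A] adds the
    missing unit, through [B] or through the interval. *)
Lemma prefix_critical B t : alpha k = 0 ->
  B \subset itv_set n 1 k -> k < t <= n ->
  \sum_(j in itv_set n 1 k :\: B) b j.+1 < alpha t ->
  \sum_(j in itv_set n 1 k :\: B) b j.+1 < beta k.+1 ->
  alpha t.-1 < alpha t -> (forall i, k < i < t -> alpha i < beta i) ->
  exists w, forall v,
    PLP_ineqs (w + v)%MM <-> touches (B :|: itv_set n k.+1 t) v.
Proof.
set sigma := \sum_(j in _) _; set A := _ :|: _.
move=> alphak /subsetP Bk kt st sb t1 ab; have k0n := PLP_k hdata.
have k1t : k < k.+1 <= t by lia.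
have tn : t <= n by lia.
have a0 : alpha k.+1.-1 <= sigma by rewrite alphak.
have [P [Pk Pt Pm Pab]] := critical_profile k1t tn a0 t1 st (fun=> sb) ab.
rewrite /= in Pk Pm.
set w := critical A k.+1 P; exists w => v.
have At j : (j \in A) = (j \in B) || (k < j.+1 <= t) by rewrite !inE.
have segw i j : k <= i <= j -> j <= t -> P i + seg w i.+1 j = P j.
  by move=> *; apply: (@seg_critical A k.+1 t) => // l lt; rewrite At; lia.
(* On the labels up to [k] this is the truncation of [w], with sum [sigma]. *)
pose c : 'X_{1..n} := [multinom if j \in A then 0 else b j.+1 | j < n].
have segc : seg c 1 k = sigma.
  rewrite /seg (big_setID B) /= big1 ?add0n => [|j].
    apply: eq_bigr => j; rewrite mnmE At !inE => jB.
    by rewrite ifN //; lia.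
  by rewrite inE mnmE At => /andP[_ ->].
split=> [[/(_ t kt) le_t _]|/existsP[j0 /andP[j0A j0v]]].
  apply: contraT => /not_touches v0; move: le_t.
  rewrite trunc_cat; last by lia.
  (* Off [A] the entries are already cut at [b], so adding [v] changes nothing. *)
  have -> : seg (trunc (w + v)%MM) 1 k = sigma.
    rewrite -segc; apply: eq_seg => j jk.
    rewrite !mnmE ifT; last by lia.
    by case: ifP => [/v0->|_]; [rewrite ifT; lia | lia].
  rewrite segD [seg v _ _](_ : _ = 0); last first.
    rewrite /seg big1 // => j; rewrite inE => jt.
    by apply: v0; rewrite At jt orbT.
  by have := segw k t; lia.
have Bj j : j \in B -> j < k by move=> /Bk; rewrite inE; lia.
(* The boolean counts 1 when the touched variable is in [B]: its entry becomes positive and survives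
   truncation because [b] is positive. *)
have segT : sigma + (j0.+1 <= k) <= seg (trunc (w + v)%MM) 1 k.
  rewrite -segc -[nat_of_bool _](seg_unit j0 1 k) -segD.
  apply: leq_seg => j /andP[_ jk]; rewrite !mnmDE !mnmE jk.
  case: eqP => [j0j|_].
    subst j; rewrite j0A.
    by have := PLP_b_gt0 hdata (i := j0.+1); case: ifP; lia.
  by rewrite addn0; case: ifP; lia.
have largeA (j : 'I_n) : t < j.+1 -> j \notin A.
  by move=> tj; rewrite At; have := Bj j; case: (j \in B) => /=; lia.
split=> [i ki | j i kji ni].
  have [it|ti] := leqP i t; last first.
    have [j jE] : exists j : 'I_n, j.+1 = i by apply: ord_of_label; lia.
    by apply: (@seg_trunc_large _ _ _ _ j) => //; [apply: largeA|]; lia.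
  rewrite trunc_cat; last by lia.
  have := segw k i; rewrite segD.
  have [it'|it'] : i = t \/ i < t by lia.
    have : (k < j0.+1) <= seg v k.+1 i.
      case: leqP => // kj0; apply: leq_trans j0v _; apply: seg_ge.
      by move: j0A; rewrite At; have := Bj j0; case: (j0 \in B) => /=; lia.
    by subst i; lia.
  by have := Pab i; lia.
have [it|ti] := leqP i t; last first.
  have [l lE] : exists j : 'I_n, j.+1 = i by apply: ord_of_label; lia.
  by apply: leq_trans (leq_addl _ _); apply: (@seg_large _ _ _ _ l) => //;
    [apply: largeA| |]; lia.
rewrite segD; have := segw j i; have := Pab j.
(* At i = t the missing unit comes from P j < beta j. *)
have [it'|it'] : i = t \/ i < t by lia.
  by subst i; lia.
by have := Pab i; lia.
Qed.

Lemma interval_critical s t :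
  k.+1 < s <= t -> t <= n ->
  beta s.-1 < beta s -> alpha t.-1 < alpha t -> beta s.-1 < alpha t ->
  (forall i, s <= i < t -> alpha i < beta i) ->
  exists w, forall v, PLP_ineqs (w + v)%MM <-> touches (itv_set n s t) v.
Proof.
set A := itv_set n s t => kst tn sb t1 st ab; have k0n := PLP_k hdata.
have kst' : k < s <= t by lia.
have ab1 : alpha s.-1 <= beta s.-1 by apply: (PLP_alpha_beta hdata); lia.
have [P [Ps Pt Pm Pab]] := critical_profile kst' tn ab1 t1 st (fun=> sb) ab.
set w := critical A s P; exists w => v.
have At j : (j \in A) = (s <= j.+1 <= t) by rewrite inE.
have segw i j : s.-1 <= i <= j -> j <= t -> P i + seg w i.+1 j = P j.
  by move=> *; apply: (@seg_critical A s t) => // [|l lt]; rewrite ?At; lia.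
split=> [[_ /(_ s.-1 t)]|/existsP[j0 /andP[j0A j0v]]].
  rewrite prednK ?tn => [le_t|]; last by lia.
  apply: contraT => /not_touches v0.
  have v00 : seg v s t = 0.
    by rewrite /seg big1 // => j; rewrite inE => jt; apply: v0; rewrite At jt.
  have := segw s.-1 t; rewrite prednK; last by lia.
  by move: le_t; rewrite segD; lia.
split=> [i ki | j i kji ni].
  (* Label k + 1 lies below [s], hence off [A], and its large entry settles the whole first
     family. *)
  have [j jE] : exists j : 'I_n, j.+1 = k.+1 by apply: ord_of_label; lia.
  by apply: (@seg_trunc_large _ _ _ _ j) => //; rewrite ?At; lia.
have [sj|js] := leqP s j.+1; last first.
  have [l lE] : exists l : 'I_n, l.+1 = j.+1 by apply: ord_of_label; lia.
  by apply: leq_trans (leq_addl _ _); apply: (@seg_large _ _ _ _ l) => //;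
    rewrite ?At; lia.
have [it|ti] := leqP i t; last first.
  have [l lE] : exists j : 'I_n, j.+1 = i by apply: ord_of_label; lia.
  by apply: leq_trans (leq_addl _ _); apply: (@seg_large _ _ _ _ l) => //;
    rewrite ?At; lia.
rewrite segD; have := segw j i.
(* Only j = s - 1 with i = t needs the unit from [v]; for j >= s, P j < beta j provides it. *)
have [it'|it'] : i = t \/ i < t by lia.
  subst i; have [js|js] : j = s.-1 \/ s <= j by lia.
    have : v j0 <= seg v s t by apply: seg_ge; rewrite -At.
    by rewrite js prednK; lia.
  by have := Pab j; lia.
have [js|js] : j = s.-1 \/ s <= j by lia.
  by have := Pab i; rewrite js; lia.
by have := Pab i; have := Pab j; lia.
Qed.

End AssociatedPrimes.

Theorem theorem5p8 (K : fieldType) (n k d : nat) (b alpha beta : nat -> nat)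
    (hdata : left_PLP_data n k d b alpha beta) (halphak : alpha k = 0%N)
    (A : {set 'I_n}) :
  associated_prime (left_PLP_ideal (K := K) (n := n) k b alpha beta)
                   (var_ideal (K := K) A)
  <->
  (exists (B : {set 'I_n}) (t : nat),
     [/\ A = B :|: itv_set n (k + 1) t,
         B \subset itv_set n 1 k,
         (k + 1 <= t <= n)%N &
         [/\ (\sum_(j in itv_set n 1 k :\: B) b j.+1
                < minn (alpha t) (beta (k + 1)))%N,
             (alpha (t - 1) < alpha t)%N &
             (forall i, (k + 1 <= i <= t - 1)%N -> (alpha i < beta i)%N)]])
  \/
  (exists s t : nat,
     [/\ A = itv_set n s t,
         (k + 2 <= s)%N /\ (s <= t <= n)%N &
         [/\ (beta (s - 1) < beta s)%N,
             (alpha (t - 1) < alpha t)%N,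
             (beta (s - 1) < alpha t)%N &
             (forall i, (s <= i <= t - 1)%N -> (alpha i < beta i)%N)]]).
Proof.
have assocP A' :
    associated_prime (left_PLP_ideal (K := K) (n := n) k b alpha beta)
                     (var_ideal (K := K) A') <->
    exists w, forall v, PLP_ineqs k b alpha beta (w + v)%MM <-> touches A' v.
  split=> [/var_ideal_associatedP[w Hw] | [w Hw]].
    by exists w => v; rewrite -Hw (PLP_upclosureP hdata).
  apply/var_ideal_associatedP; exists w => v.
  by rewrite -Hw (PLP_upclosureP hdata).
rewrite assocP; split=> [[w0 Hw0] | [[B [t]] | [s [t]]]].
(* Multiplying by variables off [A] keeps the monomial outside the ideal and makes it large
   there. *)
- pose v0 : 'X_{1..n} := [multinom if j \in A then 0 else d + b j.+1 | j < n].
  have w_fail : ~ PLP_ineqs k b alpha beta (w0 + v0)%MM.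
    rewrite Hw0 => /existsP[j /andP[jA]].
    by rewrite mnmE jA.
  have w_next j : j \in A -> PLP_ineqs k b alpha beta (w0 + v0 + U_(j))%MM.
    move=> jA; rewrite -addmA Hw0; apply/existsP; exists j.
    by rewrite jA mnmDE mnm1E eqxx addn1.
  have w_large (j : 'I_n) : j \notin A -> d + b j.+1 <= (w0 + v0)%MM j.
    by move=> jA; rewrite mnmDE mnmE (negbTE jA) leq_addl.
  have [[t kt ft]|[s [t [kst tn fst]]]] := PLP_ineqs_fail w_fail.
    by left; apply: (critical_prefix hdata w_next w_large halphak kt ft).
  by right; apply: (critical_interval hdata w_next w_large kst tn fst).
- rewrite addn1 subn1 leq_min => -[-> Bk kt [/andP[st sb] t1 ab]].
  by apply: (prefix_critical hdata) => // i ki; apply: ab; lia.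
- rewrite !subn1 => -[-> [ks stn] [sb t1 st ab]].
  by apply: (interval_critical hdata) => // [||i si]; try apply: ab; lia.
Qed.
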